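(* Let $(X,S)$, $U_i$, $m_i$, $m$ and the avalanche size function $A:X\to\{0,1,\dots,N\}$ be as in the context. For $a\in\{1,\dots,N\}$ and $1\le r\le a$ let $$K_r(a)=\Big\{(k_1,\dots,k_{r+1}):\ k_1,\dots,k_r\ge 1 \text{ integers},\ k_{r+1}=N-a,\ \sum_{i=1}^r k_i=a\Big\}.$$ Then for every $a\in\{1,\dots,N\}$ $$m(\{x\in X: A(x)=a\})=\sum_{r=1}^a\ \sum_{(k_1,\dots,k_{r+1})\in K_r(a)}\ \sum_{I_1,\dots,I_{r+1}}\ \prod_{i\in I_1} m_i(U_i)\ \prod_{l=2}^r\prod_{i\in I_l} k_{l-1}m_i(U_i)\ \prod_{i\in I_{r+1}}\bigl(1-(a+1)m_i(U_i)\bigr),$$ where $\sum_{I_1,\dots,I_{r+1}}$ denotes summation over all ordered partitions of $\{1,\dots,N\}$ into sets $I_1,\dots,I_{r+1}$ of cardinalities $k_1,\dots,k_{r+1}$ respectively ($I_{r+1}$ may be empty). For $a=0$ one has $m(\{x\in X:A(x)=0\})=\prod_{i=1}^N(1-m_i(U_i))$. In particular, if $m_i(U_i)=p$ for all $i=1,\dots,N$, then for every $a\in\{0,1,\dots,N\}$ $$m(\{x\in X: A(x)=a\})= (a+1)^{a-1}\binom{N}{a}p^a\bigl(1-(a+1)p\bigr)^{N-a}.$$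
   Context: Let $N\ge 1$ be an integer. For $i=1,\dots,N$ let $X_i$ be a metric space and $S_i:X_i\to X_i$ a continuous map. Put $X=X_1\times\cdots\times X_N$ and $S=S_1\times\cdots\times S_N$ (the product map). For each $i$ let $U_i\subset X_i$ be an open set that is the top level of a tower of height $n_i+1>N$ for $S_i$: there is a set $B_i\subset X_i$ such that the sets $S_i^k(B_i)$, $k=0,\dots,n_i$, are pairwise disjoint and $S_i^{n_i}(B_i)=U_i$. For each $i$ let $m_i$ be an $S_i$-invariant ergodic probability measure on $X_i$, and let $m=\bigotimes_{i=1}^N m_i$ be the product measure on $X$. Avalanche size: for $x=(x_1,\dots,x_N)\in X$ put $A(x,1)=|\{1\le i\le N: x_i\in U_i\}|$ and, for $k\ge 1$, $$A(x,k+1)=|\{1\le i\le N:\ \exists\, 0\le l\le A(x,k)\text{ with } S_i^l(x_i)\in U_i\}|.$$ The sequence $A(x,k)$ is nondecreasing in $k$ and there is a minimal $k\le N$ with $A(x,k+1)=A(x,k)$; the avalanche size at $x$ is $A(x)=A(x,k)$ for this $k$. Convention: empty products equal $1$ and $0^0=1$.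
   Formalization: Added hypothesis: for each i, the points outside B_i that S_i^{n_i} maps into U_i form an m_i-null set (automatic for injective S_i); without it the formula fails, e.g. when U_i is a fixed point of a non-injective S_i carrying a Dirac mass. *)

(* Defs.v *)
From HB Require Import structures.
From mathcomp Require Import all_boot all_order all_algebra.
From mathcomp Require Import all_classical all_reals all_analysis.
Set Implicit Arguments.
Unset Strict Implicit.
Unset Printing Implicit Defensive.
Import Order.TTheory GRing.Theory Num.Theory.
Import numFieldNormedType.Exports.
Local Open Scope classical_set_scope.
Local Open Scope ring_scope.

(* [measurableType] is pointed; a space carrying a probability measure is
   nonempty, so distinguishing a point loses no generality. *)
#[short(type="pmetricType")]
HB.structure Definition PointedMetric (K : numDomainType) :=
  {T of Pointed T & Metric K T}.

Definition borel (T : ptopologicalType) := g_sigma_algebraType (@open T).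

Section product_space.
Context (R : realType) (N : nat) (X : 'I_N -> pmetricType R).

Definition cylinder : set (set (forall i, X i)) :=
  [set C | exists i, exists2 E : set (borel (X i)),
     measurable E & C = (fun x => x i) @^-1` E].

(* [forall i, X i] with the product of the Borel sigma-algebras *)
Definition product_space := g_sigma_algebraType cylinder.

(* This determines [m]: measurable boxes are a pi-system generating the
   sigma-algebra of [product_space]. *)
Definition is_product_measure (mi : forall i, probability (borel (X i)) R)
    (m : probability product_space R) :=
  forall E : forall i, set (borel (X i)), (forall i, measurable (E i)) ->
  m [set x | forall i, E i (x i)] = (\prod_(i < N) mi i (E i))%E.

End product_space.

Section invariance.
Context d (T : measurableType d) (R : realType).

Definition invariant_measure (S : T -> T) (mu : probability T R) :=
  forall E, measurable E -> mu (S @^-1` E) = mu E.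

Definition ergodic (S : T -> T) (mu : probability T R) :=
  forall E, measurable E -> S @^-1` E = E -> mu E = 0%E \/ mu E = 1%E.

End invariance.

Section tower.
Context {T : Type}.

Definition is_tower (S : T -> T) (n : nat) (B U : set T) :=
  trivIset `I_n.+1 (fun k => iter k S @` B) /\ iter n S @` B = U.

(* The points that reach the top level [U] in [n] steps without starting in
   the base [B]. For a non-injective [S], [is_tower] alone does not prevent
   a point of [U] from returning to [U] in fewer than [n] steps: for
   S : 0 |-> 1 |-> 2 |-> 2 and B = {0}, the top level {2} of the tower
   {0}, {1}, {2} consists of a fixed point. Such returns (with positive measure)
   are excluded when [tower_leak] is null, which is always so for
   injective [S] by [tower_leak_inj]. *)
Definition tower_leak (S : T -> T) (n : nat) (B U : set T) : set T :=
  (iter n S @^-1` U) `\` B.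

Lemma tower_leak_inj (S : T -> T) n B U :
  injective S -> is_tower S n B U -> tower_leak S n B U = set0.
Proof.
move=> injS [_ <-]; apply/seteqP; split=> // x [[y By e]]; apply.
suff -> : x = y by [].
by elim: n e => //= n IHn /injS.
Qed.

End tower.

Section avalanche.
Context (N : nat) (X : 'I_N -> Type).
Variables (S : forall i, X i -> X i) (U : forall i, set (X i)).
Arguments S : clear implicits.
Arguments U : clear implicits.
Implicit Types x : forall i, X i.

Definition avalanche_start x : nat := #|[pred i : 'I_N | x i \in U i]|.

Definition avalanche_step x (b : nat) : nat :=
  #|[pred i : 'I_N | [exists l : 'I_b.+1, iter l (S i) (x i) \in U i]]|.

(* A(x, k) for k >= 1; the value at k = 0 is irrelevant *)
Definition avalanche_seq x (k : nat) : nat :=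
  iter k.-1 (avalanche_step x) (avalanche_start x).

Lemma avalanche_step_mono x b c :
  (b <= c)%N -> (avalanche_step x b <= avalanche_step x c)%N.
Proof.
move=> bc; apply: subset_leq_card; apply/fintype.subsetP => i.
rewrite !inE => /existsP[l hl]; apply/existsP.
by exists (widen_ord (bc : (b < c.+1)%N) l).
Qed.

Lemma avalanche_seq_mono x k :
  (avalanche_seq x k.+1 <= avalanche_seq x k.+2)%N.
Proof.
elim: k => [|k IHk]; last exact: avalanche_step_mono.
apply: subset_leq_card; apply/fintype.subsetP => i.
by rewrite !inE => Ui; apply/existsP; exists ord0; rewrite inE.
Qed.

Lemma avalanche_seq_stable x :
  exists k, (0 < k)%N && (avalanche_seq x k.+1 == avalanche_seq x k).
Proof.
apply: contrapT => H.
have lek k : (k <= avalanche_seq x k.+1)%N.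
  elim: k => // k IHk; apply: (leq_ltn_trans IHk).
  rewrite ltn_neqAle avalanche_seq_mono andbT; apply/negP => /eqP e.
  by apply: H; exists k.+1; rewrite /= -e.
have := lek N.+1; rewrite ltnNge => /negP; apply.
by rewrite -[leqRHS]card_ord; exact: max_card.
Qed.

Definition avalanche_size x : nat :=
  avalanche_seq x (ex_minn (avalanche_seq_stable x)).

End avalanche.

(* (k_1, ..., k_(r+1)) is indexed from 0, so k_j is [k (inord j.-1)]; the
   bound [N] on the entries follows from the constraints when [a <= N]. *)
Definition in_K (N r a : nat) (k : {ffun 'I_r.+1 -> 'I_N.+1}) : bool :=
  [&& [forall j : 'I_r.+1, (j < r)%N ==> (0 < k j)%N],
      (k ord_max == N - a :> nat)%N &
      (\sum_(j < r.+1 | (j < r)%N) k j == a)%N].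

Definition ordered_partition (N r : nat) (k : {ffun 'I_r.+1 -> 'I_N.+1})
    (I : {ffun 'I_r.+1 -> {set 'I_N}}) : bool :=
  [&& [forall j, #|I j| == k j :> nat],
      [forall j1, [forall j2, (j1 != j2) ==> [disjoint I j1 & I j2]]] &
      [forall i, [exists j, i \in I j]]].

(* Main.v *)
Require Import Defs.
From HB Require Import structures.
From mathcomp Require Import all_boot all_order all_algebra.
From mathcomp Require Import all_classical all_reals all_analysis.
From mathcomp Require Import ring zify.
Import Order.TTheory GRing.Theory Num.Theory.
Import numFieldNormedType.Exports.

(** Let t_i(x) be the first time at most N at which the orbit of x_i meets U_i,
    and N + 1 if there is none. The avalanche depends on x only through these
    times: it iterates the monotone map b |-> #{i : t_i <= b} starting from 0
    ([avalanche_sizeP]).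

    Law of the times. By invariance each set S_i^-j(U_i) has measure
    u_i = m_i(U_i). For j <= n_i these sets are pairwise disjoint up to null
    sets: a point of U_i that is back in U_i after 0 < d <= n_i steps can be
    pulled back n_i - d steps; the pulled back point reaches U_i in n_i steps,
    so off the leak it lies in the base B_i, and then its image after n_i - d
    steps lies in two different levels of the tower ([early_return_null]).
    Since N <= n_i, t_i takes each value 0, ..., N with probability u_i and the
    value N + 1 with the remaining probability ([measure_hit_code]). The
    coordinates are independent under m, so m(A = a) becomes a finite sum of
    products over the configurations t ([avalanche_discrete_law]).

    The sum over partitions. Sort the configurations with final value a by the
    number r of steps until the iteration stops, and record for each coordinate
    the step at which it is first counted. This gives the ordered partition
    I_1, ..., I_(r+1), where I_(r+1) holds the coordinates that are never counted.
    Conversely, once the partition is fixed, the configurations that produce it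
    form a box: the times of I_1 equal 0, those of I_l lie in the interval
    of the k_(l-1) times newly reached by the previous step, and those of
    I_(r+1) exceed a ([window_stops], [layer_of_uniq], [window_layer_of]).
    Summing the weights over this box gives the product in the theorem
    ([prod_sum_window]).

    The closed form. For equal weights p every partition contributes
    p^a (1 - (a+1)p)^(N-a) times the product of the k_(l-1)^(k_l). Removing the
    first block from a partition gives a recursion for the sum of these
    products, with the size x of the preceding block as a parameter; by the
    binomial theorem its solution is binom(N, a) x (x+a)^(a-1)
    ([sum_layered_count]), and x = 1 gives (a+1)^(a-1) binom(N, a). *)

(** * Counting layered partitions *)

Section counting.
Set Implicit Arguments.
Unset Strict Implicit.
Local Open Scope nat_scope.

Lemma eqn_bool (b c : bool) : ((b : nat) == c) = (b == c).
Proof. by case: b; case: c. Qed.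

Definition ffun_cons (A : Type) n (x : A) (g : {ffun 'I_n -> A}) :
    {ffun 'I_n.+1 -> A} :=
  [ffun j => oapp g x (unlift ord0 j)].

Lemma ffun_cons0 (A : Type) n (x : A) (g : {ffun 'I_n -> A}) :
  ffun_cons x g ord0 = x.
Proof. by rewrite ffunE unlift_none. Qed.

Lemma ffun_consS (A : Type) n (x : A) (g : {ffun 'I_n -> A}) j :
  ffun_cons x g (lift ord0 j) = g j.
Proof. by rewrite ffunE liftK. Qed.

Lemma big_ffun_cons (A : finType) n (P : pred {ffun 'I_n.+1 -> A})
    (F : {ffun 'I_n.+1 -> A} -> nat) :
  \sum_(f | P f) F f =
  \sum_(x : A) \sum_(g | P (ffun_cons x g)) F (ffun_cons x g).
Proof.
rewrite pair_big_dep /=.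
rewrite (reindex (fun p : A * {ffun 'I_n -> A} => ffun_cons p.1 p.2)) //=.
exists (fun f => (f ord0, [ffun j => f (lift ord0 j)])) => [[x g] _|f _] /=.
  congr pair; first by rewrite ffun_cons0.
  by apply/ffunP => j; rewrite ffunE ffun_consS.
by apply/ffunP => j; rewrite ffunE; case: unliftP => [i|] -> //=; rewrite ffunE.
Qed.

(** Disjointness and covering as one counting condition, which peels off a block
    at a time. *)
Definition partitions (T : finType) r (D : {set T}) (I : {ffun 'I_r -> {set T}}) :=
  [forall i, \sum_j (i \in I j) == (i \in D)].

(** The pairs (k, I) of the theorem, with k eliminated: the last block, of size
    [b], holds the elements that stay out of the cascade and may be empty. *)
Definition layered (T : finType) r b (D : {set T}) (I : {ffun 'I_r.+1 -> {set T}}) :=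
  [&& partitions D I,
      [forall j : 'I_r.+1, (j < r) ==> (I j != finset.set0)] &
      #|I ord_max| == b].

(** The number of ways to give a hitting time to each element of the first [r]
    blocks: [x] times are available to the first block, and to every other
    block as many as the preceding block has elements. *)
Definition layer_choices (T : finType) r x (I : {ffun 'I_r.+1 -> {set T}}) : nat :=
  \prod_(0 <= l < r)
    (if l is l'.+1 then #|I (inord l')| else x) ^ #|I (inord l)|.

Lemma partitions_cons (T : finType) r (D J : {set T}) (I : {ffun 'I_r -> {set T}}) :
  partitions D (ffun_cons J I) = (J \subset D) && partitions (D :\: J)%SET I.
Proof.
have E i : \sum_j (i \in ffun_cons J I j) = (i \in J) + \sum_j (i \in I j).
  rewrite big_ord_recl ffun_cons0; congr addn.
  by apply: eq_bigr => j _; rewrite ffun_consS.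
apply/forallP/andP => [H|[JD /forallP H] i].
  split; last apply/forallP => i.
    apply/fintype.subsetP => i Ji; move: (H i); rewrite E Ji.
    by case: (i \in D); case: (\sum_j _).
  move: (H i); rewrite E finset.in_setD.
  by case: (i \in D); case: (i \in J) => //=; case: (\sum_j _) => [|[]].
rewrite E; move: (H i) (fintype.subsetP JD i); rewrite finset.in_setD.
by case: (i \in J); case: (i \in D) => //= /eqP -> // /(_ isT).
Qed.

Lemma layer_choices_cons (T : finType) r x (J : {set T}) (I : {ffun 'I_r.+1 -> {set T}}) :
  layer_choices x (ffun_cons J I) = x ^ #|J| * layer_choices #|J| I.
Proof.
rewrite /layer_choices big_nat_recl //.
have inS l : l < r.+1 -> inord l.+1 = lift ord0 (inord l : 'I_r.+1) :> 'I_r.+2.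
  by move=> lr; apply: val_inj; rewrite /= /bump !inordK.
have in0 : inord 0 = ord0 :> 'I_r.+2 by apply: val_inj; rewrite /= inordK.
rewrite in0 ffun_cons0; congr muln.
apply: eq_big_nat => l /andP[_ lr].
rewrite inS ?ffun_consS; last exact: ltnW.
case: l lr => [_|l lr]; first by rewrite in0 ffun_cons0.
by rewrite inS ?ffun_consS //; exact/ltnW/ltnW.
Qed.

Lemma layered_cons (T : finType) r b (D J : {set T}) (I : {ffun 'I_r.+1 -> {set T}}) :
  layered b D (ffun_cons J I) =
  [&& J \subset D, J != finset.set0 & layered b (D :\: J)%SET I].
Proof.
have om : ord_max = lift ord0 (@ord_max r) by apply: val_inj.
have nonempty_cons :
    [forall j : 'I_r.+2, (j < r.+1) ==> (ffun_cons J I j != finset.set0)] =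
    (J != finset.set0) && [forall j : 'I_r.+1, (j < r) ==> (I j != finset.set0)].
  apply/forallP/andP => [H|[J0 /forallP H] j].
    split; first by have /= := H ord0; rewrite ffun_cons0.
    by apply/forallP => j; have := H (lift ord0 j); rewrite ffun_consS.
  case: (unliftP ord0 j) => [i|] ->; last by rewrite ffun_cons0 J0 implybT.
  by rewrite ffun_consS; exact: H.
rewrite /layered partitions_cons om ffun_consS nonempty_cons.
by case: (J \subset D); case: (J == _); case: (partitions _ I).
Qed.

Definition layered_count (T : finType) r b x (D : {set T}) :=
  \sum_(I : {ffun 'I_r.+1 -> {set T}} | layered b D I) layer_choices x I.

(** The first block [J] is any nonempty subset; for the remaining blocks its size
    takes over the part of [x]. *)
Lemma layered_countS (T : finType) r b x (D : {set T}) :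
  layered_count r.+1 b x D =
  \sum_(J : {set T} | (J \subset D) && (J != finset.set0))
    x ^ #|J| * layered_count r b #|J| (D :\: J)%SET.
Proof.
rewrite /layered_count big_ffun_cons [RHS]big_mkcond; apply: eq_bigr => J _.
under eq_bigl do rewrite layered_cons andbA.
case: ifP => _ /=; last by rewrite big_pred0.
by rewrite big_distrr; apply: eq_bigr => I _; rewrite layer_choices_cons.
Qed.

Lemma layered_count0 (T : finType) b x (D : {set T}) :
  layered_count 0 b x D = (#|D| == b).
Proof.
rewrite /layered_count (eq_bigl (fun I => (I == [ffun=> D]) && (#|D| == b))).
  rewrite big_mkcondr big_pred1_eq /layer_choices big_nil.
  by case: eqP.
move=> I; have -> : (I == [ffun=> D]) = partitions D I.
  apply/eqP/forallP => [-> i|H].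
    by rewrite big_ord1 ffunE.
  apply/ffunP => j; apply/finset.setP => i; have := H i.
  by rewrite (ord1 j) big_ord1 ffunE eqn_bool => /eqP.
rewrite /layered; have [PD|//] := boolP (partitions D I); rewrite /=.
have -> : [forall j : 'I_1, (j < 0) ==> (I j != finset.set0)] by apply/forallP.
congr (#|pred_of_set _| == b); apply/finset.setP => i.
have /forallP/(_ i) := PD.
by rewrite big_ord1 (ord1 ord_max) eqn_bool => /eqP.
Qed.

(** The Abel polynomial x (x + m)^(m - 1), which is 1 for m = 0. *)
Definition abel x m := if m is m'.+1 then x * (x + m) ^ m' else 1.

(** Multiplying by [a] absorbs the division hidden in the exponent m - 1, so that
    the cases j < a and j = a take the same form. *)
Lemma abel_mul a j : 0 < a -> j <= a -> a * abel j (a - j) = j * a ^ (a - j).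
Proof.
move=> a0 ja; case E : (a - j) => [|m] /=.
  by rewrite !muln1; apply/eqP; rewrite eqn_leq ja -subn_eq0 E.
have -> : j + m.+1 = a by rewrite -E subnKC.
by rewrite expnS mulnCA.
Qed.

Lemma sum_subsets_card (T : finType) (D : {set T}) (F : nat -> nat) :
  \sum_(J : {set T} | J \subset D) F #|J| = \sum_(j < #|D|.+1) 'C(#|D|, j) * F j.
Proof.
rewrite (partition_big (fun J : {set T} => inord #|J| : 'I_#|D|.+1) xpredT) //=.
apply: eq_bigr => j _.
rewrite (eq_bigl (fun J : {set T} => (J \subset D) && (#|J| == j))).
  rewrite (eq_bigr (fun=> F j)); last by move=> J /andP[_ /eqP ->].
  by rewrite sum_nat_const -cardsE cards_draws.
move=> J; case JD : (J \subset D) => //=.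
by rewrite -val_eqE /= inordK // ltnS subset_leq_card.
Qed.

(** The factor [j] turns binom(a, j) into a binom(a - 1, j - 1), after which the
    binomial theorem applies. *)
Lemma abel_binomial a x : 0 < a ->
  \sum_(j < a.+1) 'C(a, j) * (x ^ j * (j * a ^ (a - j))) =
  a * (x * (x + a) ^ a.-1).
Proof.
case: a => // a _ /=; rewrite big_ord_recl /= !muln0 add0n.
rewrite [x + _]addnC expnDn !big_distrr /=; apply: eq_bigr => j _.
rewrite /bump /= add1n subSS expnS.
have := mul_bin_diag a.+1 j; rewrite /=.
move: 'C(a.+1, _) 'C(a, _) (a.+1 ^ _) (x ^ _) => u v y z e.
transitivity (j.+1 * u * (x * z * y)); first by ring.
by rewrite -e; ring.
Qed.

(** Both sides count the pairs of disjoint subsets of sizes [j] and [b]. *)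
Lemma bin_trinomial n b j : 'C(n, j) * 'C(n - j, b) = 'C(n, b) * 'C(n - b, j).
Proof.
have [jbn|nlt] := leqP (j + b) n; last first.
  transitivity 0; last apply: esym.
    have [jn|nj] := leqP j n; last by rewrite bin_small.
    by rewrite [X in _ * X]bin_small ?muln0 //; lia.
  have [bn|nb] := leqP b n; last by rewrite bin_small.
  by rewrite [X in _ * X]bin_small ?muln0 //; lia.
have e1 : 'C(n, j) * (j`! * ('C(n - j, b) * (b`! * (n - j - b)`!))) = n`!.
  by rewrite !bin_fact //; lia.
have e2 : 'C(n, b) * (b`! * ('C(n - b, j) * (j`! * (n - b - j)`!))) = n`!.
  by rewrite !bin_fact //; lia.
have e3 : n - j - b = n - b - j by lia.
have pos : 0 < j`! * b`! * (n - b - j)`! by rewrite !muln_gt0 !fact_gt0.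
apply/eqP; rewrite -(eqn_pmul2r pos); apply/eqP.
transitivity n`!; [rewrite -e1 e3|rewrite -e2]; ring.
Qed.

(** Induction on the bound [s] on the number of layers, peeling the first
    block [J]. Its contribution depends on #|J| only, and the sum over #|J|
    is evaluated by [abel_binomial]. Each layer uses up at least one element, so
    a bound [s] >= #|D| - b leaves out nothing. *)
Lemma sum_layered_count (T : finType) s b x (D : {set T}) : #|D| <= b + s ->
  \sum_(r < s.+1) layered_count r b x D = 'C(#|D|, b) * abel x (#|D| - b).
Proof.
elim: s x D => [|s IHs] x D.
  rewrite addn0 leq_eqVlt big_ord1 layered_count0 => /orP[/eqP ->|lt].
    by rewrite eqxx subnn binn.
  by rewrite bin_small // ltn_eqF.
move=> Ds; rewrite big_ord_recl /= layered_count0.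
set n := #|D| in Ds *; set a := n - b.
pose F j := x ^ j * ('C(n - j, b) * abel j (a - j)).
transitivity ((n == b) + \sum_(J : {set T} | (J \subset D) && (J != finset.set0)) F #|J|).
  congr addn; rewrite (eq_bigr _ (fun r _ => layered_countS _ _ _ _)) exchange_big /=.
  apply: eq_bigr => J /andP[JD J0]; rewrite -big_distrr /=; congr muln.
  have cD : #|(D :\: J)%SET| = n - #|J|.
    by rewrite cardsD (finset.setIidPr JD).
  rewrite IHs cD ?/a 1?subnAC //.
  by move: J0; rewrite -card_gt0; lia.
have F0 j : j <= n -> n < b + j -> F j = 0.
  by move=> jn nj; rewrite /F bin_small ?muln0 //; lia.
have Jgt0 (J : {set T}) : (J \subset D) && (J != finset.set0) -> 0 < #|J| <= n.
  by case/andP => /subset_leq_card ->; rewrite -card_gt0 andbT.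
have [nb|bn|nb] := ltngtP n b.
- rewrite bin_small // add0n big1 // => J /Jgt0 /andP[J0 Jn]; apply: F0 => //; lia.
- rewrite add0n; have a0 : 0 < a by rewrite subn_gt0.
  have aE : abel x a = x * (x + a) ^ a.-1 by rewrite -(prednK a0).
  (* The empty J, excluded from the sum, may be added after multiplication by a,
     because the summand G then carries the factor j. *)
  apply/eqP; rewrite aE -(eqn_pmul2l a0) mulnCA -abel_binomial //.
  pose G j := x ^ j * ('C(n - j, b) * (j * a ^ (a - j))).
  have FG j : 0 < j <= n -> a * F j = G j.
    move=> /andP[j0 jn]; rewrite /F /G mulnCA [a * _]mulnCA.
    have [ja|aj] := leqP j a; first by rewrite abel_mul.
    by rewrite bin_small //; rewrite /a in aj; lia.
  apply/eqP; rewrite big_distrr /=.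
  transitivity (\sum_(J : {set T} | J \subset D) G #|J|).
    rewrite [RHS](bigD1 finset.set0) ?finset.sub0set //=.
    rewrite {1}/G cards0 mul0n !muln0 add0n.
    by apply: eq_bigr => J /Jgt0; exact: FG.
  rewrite (sum_subsets_card D G) -/n big_distrr /=.
  rewrite [RHS](big_ord_widen n.+1
    (fun j => 'C(n, b) * ('C(a, j) * (x ^ j * (j * a ^ (a - j))))));
    last by rewrite ltnS leq_subr.
  rewrite [RHS]big_mkcond /=; apply: eq_bigr => j _.
  have -> : 'C(n, j) * G j = 'C(n, b) * 'C(a, j) * (x ^ j * (j * a ^ (a - j))).
    by rewrite /G /a -bin_trinomial; ring.
  rewrite ltnS; case: leqP => aj; first by rewrite -mulnA.
  by rewrite [X in _ * X * _]bin_small ?muln0 ?mul0n.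
- rewrite /a nb subnn binn big1 // => J /Jgt0 /andP[J0 Jn]; apply: F0 => //; lia.
Qed.
End counting.

(** * Cascades and their layers *)

Section cascade.
Set Implicit Arguments.
Unset Strict Implicit.
Local Open Scope nat_scope.
Context (T : finType).
Implicit Types c : T -> nat.

(** [c i] is the time at which [i] would topple: [i] takes part in the cascade as
    soon as [c i] toppled elements have been counted. *)
Definition activated c b := #|[set i | c i <= b]%SET|.

Definition sweep c j := iter j (activated c) 0.

(** The iteration from 0 increases strictly for exactly [r] steps and then rests
    at [a]. *)
Definition stops c r a :=
  [&& sweep c r == a, activated c a == a & [forall j : 'I_r, sweep c j < sweep c j.+1]].

Lemma activated_mono c b b' : b <= b' -> activated c b <= activated c b'.
Proof.
move=> bb'; apply: subset_leq_card; apply/fintype.subsetP => i.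
by rewrite !finset.inE => /leq_trans; apply.
Qed.

Lemma sweep_mono c j j' : j <= j' -> sweep c j <= sweep c j'.
Proof.
have S k : sweep c k <= sweep c k.+1 by elim: k => // k; exact: activated_mono.
move=> jj'; rewrite -(subnK jj'); elim: (j' - j) => // d IH.
by rewrite addSn; apply: leq_trans (S _).
Qed.

Lemma sweep_stable c r a j :
  sweep c r = a -> activated c a = a -> r <= j -> sweep c j = a.
Proof.
move=> ra aa rj; rewrite -(subnK rj); elim: (j - r) => // d IH.
by rewrite addSn /sweep iterS -/(sweep _ _) IH.
Qed.

Lemma stops_uniq c r r' a : stops c r a -> stops c r' a -> r = r'.
Proof.
wlog : r r' / r < r'.
  move=> W Hr Hr'; have [lt|gt|//] := ltngtP r r'; first exact: W.
  by apply: esym; apply: W.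
move=> lt /and3P[/eqP e /eqP fe _] /and3P[_ _ /forallP H].
have : sweep c r < sweep c r.+1 := H (Ordinal lt).
by rewrite !(sweep_stable e fe) ?ltnn.
Qed.

(** Every strict increase adds at least 1, hence r <= a. *)
Lemma stops_exists c k a : sweep c k = a -> activated c a = a ->
  exists2 r, r <= a & stops c r a.
Proof.
move=> ka aa.
have ex : exists j, sweep c j == sweep c j.+1.
  by exists k; rewrite !(sweep_stable ka aa) //; lia.
case: (ex_minnP ex) => r /eqP er rmin.
have lt j : j < r -> sweep c j < sweep c j.+1.
  move=> jr; rewrite ltn_neqAle sweep_mono ?leqnSn // andbT.
  by apply/negP => /rmin; rewrite leqNgt jr.
have ra : sweep c r = a.
  have [kr|rk] := leqP k r; first exact: (sweep_stable ka aa).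
  rewrite -ka; apply: esym; apply: (sweep_stable erefl) (ltnW rk).
  by rewrite [RHS]er.
have le j : j <= r -> j <= sweep c j.
  by elim: j => // j IH jr; apply: leq_ltn_trans (lt _ jr); apply/IH/ltnW.
exists r; first by rewrite -ra; exact: le.
by rewrite /stops ra aa !eqxx; apply/forallP => j; exact: lt.
Qed.

(** An ordered partition into r + 1 blocks is the same as the map [h] that sends
    an element to the index of its block. *)
Definition fibers r (h : {ffun T -> 'I_r.+1}) : {ffun 'I_r.+1 -> {set T}} :=
  [ffun j => [set i | h i == j]%SET].

Definition upto r (h : {ffun T -> 'I_r.+1}) j := #|[set i | h i < j]%SET|.

(** The hitting times that put an element into block [l], if the blocks have the
    sizes prescribed by [h]: those counted at sweep l + 1 but not at sweep l,
    and for the last block those never counted. *)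
Definition window r (h : {ffun T -> 'I_r.+1}) l y :=
  if l < r then ((l == 0) || (upto h l.-1 < y)) && (y <= upto h l)
  else upto h r < y.

Definition layering a r (h : {ffun T -> 'I_r.+1}) :=
  layered (#|T| - a) [set: T]%SET (fibers h).

Lemma upto_mono r (h : {ffun T -> 'I_r.+1}) j j' : j <= j' -> upto h j <= upto h j'.
Proof.
move=> jj'; apply: subset_leq_card; apply/fintype.subsetP => i.
by rewrite !finset.inE => /leq_trans; apply.
Qed.

Lemma upto0 r (h : {ffun T -> 'I_r.+1}) : upto h 0 = 0.
Proof. by apply/eqP; rewrite cards_eq0; apply/eqP/finset.setP => i; rewrite !finset.inE. Qed.

Lemma uptoS r (h : {ffun T -> 'I_r.+1}) (j : 'I_r.+1) :
  upto h j.+1 = upto h j + #|fibers h j|.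
Proof.
rewrite /upto ffunE -cardsUI [X in _ = _ + X](_ : _ = 0) ?addn0.
  apply: eq_card => i; rewrite !finset.inE ltnS leq_eqVlt orbC.
  by rewrite -val_eqE.
apply/eqP; rewrite cards_eq0; apply/eqP/finset.setP => i; rewrite !finset.inE.
by apply/andP => -[+ /eqP e]; rewrite e ltnn.
Qed.

Lemma partitions_fibers r (h : {ffun T -> 'I_r.+1}) :
  partitions [set: T]%SET (fibers h).
Proof.
apply/forallP => i; rewrite (bigD1 (h i)) //= big1 ?addn0 => [|j /negPf hj].
  by rewrite ffunE !finset.inE eqxx.
by rewrite ffunE finset.inE eq_sym hj.
Qed.

Lemma upto_last r (h : {ffun T -> 'I_r.+1}) :
  upto h r + #|fibers h ord_max| = #|T|.
Proof.
rewrite -(uptoS h ord_max) /upto -[RHS]cardsT; apply: eq_card => i.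
by rewrite !finset.inE ltn_ord.
Qed.

Lemma layeringP a r (h : {ffun T -> 'I_r.+1}) : a <= #|T| ->
  reflect (upto h r = a /\ forall j, j < r -> upto h j < upto h j.+1)
          (layering a h).
Proof.
move=> aT; rewrite /layering /layered partitions_fibers /=.
apply: (iffP andP) => [[/forallP H /eqP e]|[e H]]; split.
- by apply: (@addIn #|fibers h ord_max|); rewrite upto_last e subnKC.
- move=> j jr; have := H (inord j); rewrite inordK; last exact: ltnW.
  rewrite jr /= -card_gt0 => p.
  have := uptoS h (inord j); rewrite inordK; last exact: ltnW.
  by move: p; set x := #|_|; lia.
- apply/forallP => j; apply/implyP => /H; rewrite uptoS -card_gt0.
  by set x := #|_|; lia.
- by apply/eqP/(@addnI (upto h r)); rewrite upto_last e subnKC.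
Qed.

Section window_to_stop.
Variables (r : nat) (h : {ffun T -> 'I_r.+1}) (c : T -> nat).
Hypothesis wh : forall i, window h (h i) (c i).

(** The windows of the blocks are consecutive intervals, so membership in a block
    of index at most [j] is a bound on the hitting time. This makes the sweeps
    of [c] count the blocks of [h]. *)
Lemma window_le i j : j < r -> (c i <= upto h j) = (h i <= j).
Proof.
move=> jr; have := wh i; rewrite /window; case: ifP => [hr|/negbT].
  case/andP => lo hi; apply/idP/idP => [cj|hj].
    rewrite leqNgt; apply/negP => jh; move: lo.
    have -> : (h i == 0 :> nat) = false by lia.
    rewrite /= ltnNge => /negP; apply; apply: leq_trans cj _.
    by apply: upto_mono; lia.
  by apply: leq_trans hi _; exact: upto_mono.
rewrite -leqNgt => rh cr.
have -> : (h i <= j) = false by apply/negbTE; lia.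
apply/negbTE; rewrite -ltnNge; apply: leq_ltn_trans cr; apply: upto_mono; lia.
Qed.

Lemma window_le_last i : (c i <= upto h r) = (h i < r).
Proof.
have := wh i; rewrite /window; case: ifP => [hr /andP[_ ]|/negbT hr].
  by move=> /leq_trans -> //; exact/upto_mono/ltnW.
by rewrite ltnNge => /negbTE.
Qed.

Lemma window_sweep j : j <= r -> sweep c j = upto h j.
Proof.
elim: j => [|j IH] jr; first by rewrite upto0.
rewrite /sweep iterS -/(sweep c j) IH; last exact: ltnW.
by apply: eq_card => i; rewrite !finset.inE window_le.
Qed.

Lemma window_stops a : a <= #|T| -> layering a h -> stops c r a.
Proof.
move=> aT hh; have [ra inc] := layeringP h aT hh.
rewrite /stops window_sweep // ra eqxx /=; apply/andP; split.
  apply/eqP; rewrite -[RHS]ra; apply: eq_card => i.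
  by rewrite !finset.inE -ra window_le_last.
apply/forallP => j; have jr := ltn_ord j.
by have := inc _ jr; rewrite -(window_sweep jr) -(window_sweep (ltnW jr)).
Qed.

End window_to_stop.

(** The index of the first sweep that counts [i], or [r] if the first [r] sweeps
    do not count it. *)
Definition layer_of r c : {ffun T -> 'I_r.+1} :=
  [ffun i => inord (find (fun j => c i <= sweep c j) (iota 0 r))].

Lemma layer_ofE r c i :
  layer_of r c i = find (fun j => c i <= sweep c j) (iota 0 r) :> nat.
Proof. by rewrite ffunE inordK // ltnS -[leqRHS](size_iota 0) find_size. Qed.

Lemma layer_of_le r c i j : j < r -> (layer_of r c i <= j) = (c i <= sweep c j).
Proof.
move=> jr; rewrite layer_ofE; apply/idP/idP => [lej|cj].
  have := @nth_find _ 0 (fun j => c i <= sweep c j) (iota 0 r).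
  rewrite has_find size_iota (leq_ltn_trans lej jr) => /(_ isT).
  rewrite nth_iota; last exact: leq_ltn_trans jr.
  by move=> /leq_trans; apply; exact: sweep_mono.
rewrite leqNgt; apply/negP => /(before_find 0).
by rewrite nth_iota // add0n cj.
Qed.

Lemma layer_of_uniq a r (h : {ffun T -> 'I_r.+1}) c :
  a <= #|T| -> layering a h -> (forall i, window h (h i) (c i)) -> h = layer_of r c.
Proof.
move=> aT hh wh; apply/ffunP => i.
have E j : j < r -> (h i <= j) = (layer_of r c i <= j).
  by move=> jr; rewrite layer_of_le // (window_sweep wh) ?(window_le wh) // ltnW.
apply/val_inj/eqP; rewrite /= eqn_leq.
have := ltn_ord (h i); have := ltn_ord (layer_of r c i); rewrite !ltnS => lr hr.
apply/andP; split.
  by have [lt|] := ltnP (layer_of r c i) r; [rewrite E|move=> /(leq_trans hr)].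
by have [lt|] := ltnP (h i) r; [rewrite -E|move=> /(leq_trans lr)].
Qed.

Section stop_to_window.
Variables (a r : nat) (c : T -> nat).
Hypotheses (aT : a <= #|T|) (r0 : 0 < r) (sc : stops c r a).
Let h := layer_of r c.

Lemma upto_layer_of j : j <= r -> upto h j = sweep c j.
Proof.
case: j => [|j] jr; first by rewrite upto0.
by apply: eq_card => i; rewrite !finset.inE ltnS layer_of_le.
Qed.

Lemma layering_layer_of : layering a h.
Proof.
case/and3P: sc => /eqP ra _ /forallP inc; apply/layeringP => //.
split=> [|j jr]; first by rewrite upto_layer_of.
by rewrite !upto_layer_of ?(ltnW jr) //; exact: (inc (Ordinal jr)).
Qed.

(** For the last block one needs a < c i, while the definition of [layer_of] only
    says that sweep [r] has not counted [i]. Sweeps [r] and r + 1 both have the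
    value [a] and the first set is contained in the second, so they count
    the same elements. *)
Lemma window_layer_of i : window h (h i) (c i).
Proof.
case/and3P: sc => /eqP ra /eqP aa _; rewrite /window; case: ifP => [hr|/negbT hr].
  have -> : c i <= upto h (h i).
    by rewrite (upto_layer_of (ltnW hr)) -(layer_of_le c i hr).
  rewrite andbT.
  case: eqP => //= /eqP; rewrite -lt0n => h0.
  have pr : (h i).-1 < r by lia.
  by rewrite /= (upto_layer_of (ltnW pr)) ltnNge -(layer_of_le c i pr) -/h; lia.
rewrite upto_layer_of // ra ltnNge; apply: contra hr => ca.
have e : [set i | c i <= sweep c r.-1]%SET = [set i | c i <= a]%SET.
  apply/eqP; rewrite finset.eqEcard; apply/andP; split.
    apply/fintype.subsetP => k; rewrite !finset.inE => /leq_trans; apply.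
    by rewrite -ra sweep_mono // leq_pred.
  by rewrite -/(activated c a) aa -ra -{1}(prednK r0).
have : i \in [set i | c i <= a]%SET by rewrite finset.inE.
have pr : r.-1 < r by lia.
by rewrite -e finset.inE -(layer_of_le c i pr) -/h; lia.
Qed.
End stop_to_window.

(** The configurations that stop after [r] sweeps are classified by their layers,
    and those with given layers form a box, over which the sum of products is
    a product of sums. *)
Lemma sum_stops (R : comPzRingType) M a r (w : T -> 'I_M -> R) :
  a <= #|T| -> 0 < r ->
  (\sum_(c : {ffun T -> 'I_M} | stops (fun i => c i) r a) \prod_i w i (c i) =
   \sum_(h : {ffun T -> 'I_r.+1} | layering a h)
      \prod_i \sum_(y : 'I_M | window h (h i) y) w i y)%R.
Proof.
move=> aT r0.
rewrite (partition_big (fun c : {ffun T -> 'I_M} => layer_of r (fun i => c i))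
  (@layering a r)) /=; last first.
  by move=> c sc; exact: layering_layer_of.
apply: eq_bigr => h hh.
rewrite (bigA_distr_big_dep (fun i (y : 'I_M) => window h (h i) y)) /=.
apply: eq_bigl => c; apply/andP/familyP => [[sc /eqP <-] i|wh].
  exact: (window_layer_of aT r0 sc).
have {}wh i : window h (h i) (c i) by exact: (wh i).
split; first exact: (window_stops wh aT hh).
by apply/eqP; rewrite [RHS](layer_of_uniq aT hh wh).
Qed.
End cascade.

(** * The cascade under independent uniform hitting times *)

Section law.
Set Implicit Arguments.
Unset Strict Implicit.
Local Open Scope ring_scope.
Context (R : comPzRingType) (N : nat).
Implicit Types u : 'I_N -> R.

(** The law of one hitting time; the value N + 1 stands for no hit up to time N. *)
Definition hit_weight u (i : 'I_N) (y : 'I_N.+2) : R :=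
  if (y <= N)%N then u i else 1 - N.+1%:R * u i.

Lemma card_ord_range M lo hi : (hi <= M)%N ->
  #|[pred y : 'I_M | (lo <= y < hi)%N]| = (hi - lo)%N.
Proof.
move=> hM; rewrite -sum1_card -(big_mkord (fun y => lo <= y < hi)%N (fun=> 1%N)).
rewrite -(big_nat_widen 0 hi M (fun y => lo <= y)%N (fun=> 1%N)) //.
have [lh|hl] := leqP lo hi.
  by rewrite -(big_nat_widenl _ _ _ predT (fun=> 1%N)) // sum_nat_const_nat muln1.
rewrite big_nat_cond big_pred0 => [|y]; first by apply/eqP; rewrite eq_sym subn_eq0 ltnW.
by apply/negbTE; lia.
Qed.

Lemma sum_hit_weight u i : \sum_y hit_weight u i y = 1.
Proof.
rewrite big_ord_recr /= {2}/hit_weight /= ltnn.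
rewrite (eq_bigr (fun=> u i)) => [|y _]; last by rewrite /hit_weight /= -ltnS ltn_ord.
by rewrite sumr_const card_ord -[u i *+ _]mulr_natl addrC subrK.
Qed.

Lemma sum_hit_weight_range u i lo hi : (hi <= N.+1)%N ->
  \sum_(y : 'I_N.+2 | (lo <= y < hi)%N) hit_weight u i y = (hi - lo)%:R * u i.
Proof.
move=> hN; rewrite (eq_bigr (fun=> u i)) => [|y /andP[_ yh]].
  by rewrite sumr_const card_ord_range ?mulr_natl // ltnW.
by rewrite /hit_weight -ltnS (leq_trans yh).
Qed.

Lemma sum_hit_weight_tail u i a : (a <= N)%N ->
  \sum_(y : 'I_N.+2 | (a < y)%N) hit_weight u i y = 1 - a.+1%:R * u i.
Proof.
move=> aN; rewrite -[X in _ = X - _](sum_hit_weight u i).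
rewrite [in RHS](bigID (fun y : 'I_N.+2 => a < y)%N) /=.
rewrite [X in _ + X - _](eq_bigl (fun y : 'I_N.+2 => 0 <= y < a.+1)%N) => [|y].
  by rewrite sum_hit_weight_range // subn0 addrK.
by rewrite -leqNgt.
Qed.

(** The window of block l > 0 has as many points as block l - 1 has elements,
    since its end points are the numbers of elements in the first l - 1 and in
    the first l blocks. *)
Lemma sum_window u a r (h : {ffun 'I_N -> 'I_r.+1}) i (l : 'I_r.+1) :
  (a <= N)%N -> layering a h ->
  \sum_(y : 'I_N.+2 | window h l y) hit_weight u i y =
  if (l < r)%N
  then (if nat_of_ord l is l'.+1 then #|fibers h (inord l')| else 1%N)%:R * u i
  else 1 - a.+1%:R * u i.
Proof.
move=> aN hh; have aT : (a <= #|'I_N|)%N by rewrite card_ord.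
have [ra inc] := layeringP h aT hh.
have upN j : (upto h j <= N)%N by rewrite -[leqRHS]card_ord max_card.
rewrite /window; case: ifP => lr; last by rewrite ra sum_hit_weight_tail.
case: l lr => -[|l] lt /= lr.
  rewrite (eq_bigl (fun y : 'I_N.+2 => 0 <= y < (upto h 0).+1)%N) //.
  by rewrite sum_hit_weight_range // upto0.
rewrite (eq_bigl (fun y : 'I_N.+2 => (upto h l).+1 <= y < (upto h l.+1).+1)%N) //.
rewrite sum_hit_weight_range ?ltnS ?upN // subSS; congr (_%:R * _).
have := uptoS h (inord l); rewrite inordK; last by lia.
by move=> ->; rewrite addKn.
Qed.

Definition layer_product u a r (k : 'I_r.+1 -> nat)
    (I : {ffun 'I_r.+1 -> {set 'I_N}}) :=
  (\prod_(i in I ord0) u i)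
  * (\prod_(1 <= l < r) \prod_(i in I (inord l)) ((k (inord l.-1))%:R * u i))
  * \prod_(i in I ord_max) (1 - a.+1%:R * u i).

Lemma prod_sum_window u a r (h : {ffun 'I_N -> 'I_r.+1}) :
  (0 < r)%N -> (a <= N)%N -> layering a h ->
  \prod_i \sum_(y : 'I_N.+2 | window h (h i) y) hit_weight u i y =
  layer_product u a (fun j => #|fibers h j|) (fibers h).
Proof.
move=> r0 aN hh.
rewrite (partition_big h xpredT) //= big_ord_recr /=; congr (_ * _); last first.
  apply: eq_big => [i|i /eqP ->]; first by rewrite ffunE finset.inE.
  by rewrite (sum_window u i ord_max aN hh) ltnn.
rewrite (eq_bigr (fun l : 'I_r => \prod_(i in fibers h (inord l))
    ((if nat_of_ord l is l'.+1 then #|fibers h (inord l')| else 1%N)%:R * u i))); last first.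
  move=> l _.
  have e : inord l = widen_ord (leqnSn r) l.
    by apply: val_inj; rewrite /= inordK // ltnW // ltnS.
  rewrite e; apply: eq_big => [i|i /eqP ->]; first by rewrite ffunE finset.inE.
  by rewrite (sum_window u i _ aN hh) /= ltn_ord.
rewrite -(big_mkord xpredT (fun l => \prod_(i in fibers h (inord l))
    ((if l is l'.+1 then #|fibers h (inord l')| else 1%N)%:R * u i))).
rewrite big_ltn //; congr (_ * _).
  have -> : inord 0 = ord0 :> 'I_r.+1 by apply: val_inj; rewrite /= inordK.
  by apply: eq_bigr => i _; rewrite mul1r.
by apply: eq_big_nat => -[|l] // _.
Qed.

Lemma reindex_fibers a r (F : {ffun 'I_r.+1 -> {set 'I_N}} -> R) :
  \sum_(I | layered (N - a)%N [set: 'I_N]%SET I) F I =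
  \sum_(h : {ffun 'I_N -> 'I_r.+1} | layering a h) F (fibers h).
Proof.
rewrite (reindex (@fibers _ r)) /=.
  by apply: eq_bigl => h; rewrite /layering card_ord.
exists (fun I : {ffun 'I_r.+1 -> {set 'I_N}} =>
  [ffun i => odflt ord0 [pick j | i \in I j]]).
  move=> h _; apply/ffunP => i; rewrite ffunE; case: pickP => /= [j|/(_ (h i))].
    by rewrite ffunE finset.inE => /eqP.
  by rewrite ffunE finset.inE eqxx.
move=> I; rewrite inE => /and3P[/forallP pI _ _].
apply/ffunP => j; apply/finset.setP => i; rewrite ffunE finset.inE ffunE.
have := pI i; rewrite finset.inE.
case: pickP => /= [j' ij'|none]; last by rewrite big1 // => j' _; rewrite none.
rewrite (bigD1 j') //= ij' => /eqP[/eqP]; rewrite sum_nat_eq0 => /forallP others.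
apply/eqP/idP => [<- //|ij]; apply/eqP; apply: contraT => jj'.
by have := others j; rewrite ij eq_sym jj'.
Qed.

Lemma sum_stops_layers u a r : (0 < r)%N -> (a <= N)%N ->
  \sum_(c : {ffun 'I_N -> 'I_N.+2} | stops (fun i => c i) r a)
    \prod_i hit_weight u i (c i) =
  \sum_(I : {ffun 'I_r.+1 -> {set 'I_N}} | layered (N - a)%N [set: 'I_N]%SET I)
    layer_product u a (fun j => #|I j|) I.
Proof.
move=> r0 aN; rewrite sum_stops ?card_ord // reindex_fibers.
by apply: eq_bigr => h hh; exact: prod_sum_window.
Qed.

(** The tuple [k] only records the sizes of the blocks, and the requirement that
    the first [r] sizes add up to [a] follows from the size of the last one. *)
Lemma ordered_partitionE a r (k : {ffun 'I_r.+1 -> 'I_N.+1}) I : (a <= N)%N ->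
  in_K a k && ordered_partition k I =
  layered (N - a)%N [set: 'I_N]%SET I && (k == [ffun j => inord #|I j|]).
Proof.
move=> aN; apply/andP/andP.
  case=> /and3P[/forallP kpos /eqP klast _].
  case/and3P=> [/forallP Ik /forallP Idis /forallP Icov].
  split; last first.
  by apply/eqP/ffunP => j; rewrite ffunE (eqP (Ik j)) inord_val.
  apply/and3P; split; last by rewrite (eqP (Ik _)) klast.
    apply/forallP => i; rewrite finset.inE; have /existsP[j ij] := Icov i.
    rewrite (bigD1 j) //= ij big1 // => j' j'j; have /forallP/(_ j) := Idis j'.
    rewrite j'j => /disjointFl/(_ ij) -> //.
  apply/forallP => j; apply/implyP => jr; have /implyP/(_ jr) := kpos j.
  by rewrite -(eqP (Ik j)) card_gt0.
case=> /and3P[/forallP pI /forallP Ipos /eqP Ilast] /eqP ->.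
have Ilt (J : {set 'I_N}) : (#|J| < N.+1)%N by rewrite ltnS -[leqRHS]card_ord max_card.
have pI1 i : (\sum_j (i \in I j) = 1)%N by have := pI i; rewrite finset.inE => /eqP.
have total : (\sum_j #|I j| = N)%N.
  transitivity (\sum_j \sum_(i : 'I_N) (i \in I j))%N.
    by apply: eq_bigr => j _; rewrite -sum1_card big_mkcond.
  rewrite exchange_big /= (eq_bigr (fun=> 1%N)) => [|i _]; last exact: pI1.
  by rewrite sum1_card card_ord.
split.
  apply/and3P; split.
  - apply/forallP => j; apply/implyP => jr; have /implyP/(_ jr) := Ipos j.
    by rewrite ffunE inordK // card_gt0.
  - by rewrite ffunE inordK // Ilast.
  - move: total; rewrite (bigD1 ord_max) //= Ilast => total.
    apply/eqP/(@addnI (N - a)%N); rewrite subnK // -[RHS]total; congr addn.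
    apply: eq_big => [j|j _]; last by rewrite ffunE inordK.
    by rewrite -val_eqE /= ltn_neqAle -ltnS ltn_ord andbT.
apply/and3P; split.
- by apply/forallP => j; rewrite ffunE inordK.
- apply/forallP => j1; apply/forallP => j2; apply/implyP => j12.
  apply/pred0P => i; apply/negbTE/negP => /andP[/= i1 i2].
  by have := pI1 i; rewrite (bigD1 j1) //= (bigD1 j2) 1?eq_sym //= i1 i2.
- apply/forallP => i; apply/existsP; apply: contrapT => none.
  have := pI1 i; rewrite big1 // => j _; case ij : (i \in I j) => //.
  by case: none; exists j.
Qed.

Lemma sum_ordered_partition u a r : (a <= N)%N ->
  \sum_(k : {ffun 'I_r.+1 -> 'I_N.+1} | in_K a k)
    \sum_(I : {ffun 'I_r.+1 -> {set 'I_N}} | ordered_partition k I)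
      layer_product u a (fun j => k j) I =
  \sum_(I : {ffun 'I_r.+1 -> {set 'I_N}} | layered (N - a)%N [set: 'I_N]%SET I)
    layer_product u a (fun j => #|I j|) I.
Proof.
move=> aN; rewrite (exchange_big_dep xpredT) //= [RHS]big_mkcond; apply: eq_bigr => I _.
rewrite (eq_bigl _ _ (fun k => ordered_partitionE k I aN)).
case: ifP => _ /=; last by rewrite big_pred0.
rewrite big_pred1_eq; congr (_ * _ * _).
apply: eq_bigr => l _; apply: eq_bigr => i _.
by rewrite ffunE inordK // ltnS -[leqRHS]card_ord max_card.
Qed.

Lemma layer_product_const (p : R) a r (I : {ffun 'I_r.+1 -> {set 'I_N}}) :
  (0 < r)%N -> (a <= N)%N -> layered (N - a)%N [set: 'I_N]%SET I ->
  layer_product (fun=> p) a (fun j => #|I j|) I =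
  (layer_choices 1 I)%:R * (p ^+ a * (1 - a.+1%:R * p) ^+ (N - a)).
Proof.
move=> r0 aN lI.
have /andP[/and3P[_ _ /eqP size_a] _] :
    in_K a [ffun j => inord #|I j| : 'I_N.+1] &&
    ordered_partition [ffun j => inord #|I j| : 'I_N.+1] I.
  by rewrite ordered_partitionE // lI eqxx.
have /and3P[_ _ /eqP last_size] := lI.
have {}size_a : (\sum_(0 <= l < r) #|I (inord l)| = a)%N.
  rewrite -[RHS]size_a big_mkord (big_ord_narrow (leqnSn r)).
  apply: eq_bigr => l _.
  rewrite ffunE inordK; last by rewrite ltnS -[leqRHS]card_ord max_card.
  by congr (#|pred_of_set (I _)|); apply: val_inj; rewrite /= inordK // ltnW // ltnS.
rewrite /layer_product [X in _ * X]prodr_const last_size mulrA; congr (_ * _).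
rewrite -size_a -prodrXr /layer_choices natr_prod -big_split /= [RHS]big_ltn //.
have -> : inord 0 = ord0 :> 'I_r.+1 by apply: val_inj; rewrite /= inordK.
rewrite prodr_const /= exp1n mul1r; congr (_ * _).
apply: eq_big_nat => -[|l] // _.
by rewrite prodr_const exprMn natrX.
Qed.

Lemma sum_layer_product_const (p : R) a : (0 < a <= N)%N ->
  \sum_(1 <= r < a.+1)
    \sum_(I : {ffun 'I_r.+1 -> {set 'I_N}} | layered (N - a)%N [set: 'I_N]%SET I)
      layer_product (fun=> p) a (fun j => #|I j|) I =
  (a.+1 ^ a.-1 * 'C(N, a))%:R * (p ^+ a * (1 - a.+1%:R * p) ^+ (N - a)).
Proof.
case/andP=> a0 aN.
transitivity (\sum_(1 <= r < a.+1) (layered_count r (N - a)%N 1 [set: 'I_N]%SET)%:R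
   * (p ^+ a * (1 - a.+1%:R * p) ^+ (N - a))).
  apply: eq_big_nat => r /andP[r0 _]; rewrite natr_sum mulr_suml.
  by apply: eq_bigr => I; exact: layer_product_const.
rewrite -mulr_suml -natr_sum; congr (_%:R * _).
have := @sum_layered_count _ a (N - a) 1 [set: 'I_N]%SET.
rewrite cardsT card_ord subnK // => /(_ (leqnn _)).
rewrite -(big_mkord xpredT (fun r => layered_count r (N - a)%N 1 [set: 'I_N]%SET)).
rewrite big_ltn //.
rewrite layered_count0 cardsT card_ord.
(* r = 0 would require the last block to be everything. *)
have -> : (N == N - a)%N = false by lia.
rewrite add0n => ->; rewrite bin_sub // subKn // mulnC; congr muln.
by rewrite -(prednK a0) /= mul1n.
Qed.
End law.

Section discrete_law.
Set Implicit Arguments.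
Unset Strict Implicit.
Local Open Scope ring_scope.
Context (R : comPzRingType) (N : nat).

(** The probability that the cascade of independent hitting times with law
    [hit_weight] ends at [a]. *)
Definition discrete_law (u : 'I_N -> R) a : R :=
  \sum_(c : {ffun 'I_N -> 'I_N.+2} | [exists r : 'I_a.+1, stops (fun i => c i) r a])
    \prod_i hit_weight u i (c i).

(** The number of sweeps is determined by the configuration ([stops_uniq]), so
    splitting by it counts nothing twice. *)
Lemma discrete_lawE u a : discrete_law u a =
  \sum_(0 <= r < a.+1)
    \sum_(c : {ffun 'I_N -> 'I_N.+2} | stops (fun i => c i) r a)
      \prod_i hit_weight u i (c i).
Proof.
rewrite big_mkord (exchange_big_dep xpredT) //= /discrete_law big_mkcond.
apply: eq_bigr => c _; case: ifP => [/existsP[r0 s0]|/negbT/existsPn none].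
  rewrite (big_pred1 r0) // => r; apply/idP/eqP => [s|->//].
  by apply: val_inj; exact: stops_uniq s s0.
by rewrite big_pred0 // => r; apply/negbTE.
Qed.

Lemma discrete_law0 u : discrete_law u 0 = \prod_i (1 - u i).
Proof.
rewrite discrete_lawE big_nat1.
rewrite (eq_bigl (fun c : {ffun 'I_N -> 'I_N.+2} =>
  c \in family (fun i => [pred y : 'I_N.+2 | 0 < y])%N)).
  rewrite -(bigA_distr_big_dep (fun i (y : 'I_N.+2) => 0 < y)%N).
  by apply: eq_bigr => i _; rewrite sum_hit_weight_tail // mul1r.
move=> c; rewrite /stops /= ?eqxx /=.
have -> : [forall j : 'I_0, (sweep (fun i => c i) j < sweep (fun i => c i) j.+1)%N].
  by apply/forallP => -[].
rewrite andbT cards_eq0; apply/eqP/familyP => [e i|pos].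
  rewrite inE lt0n -leqn0; apply/negP => ci.
  have : i \in (finset.set0 : {set _}) by rewrite -e finset.inE.
  by rewrite finset.inE.
apply/finset.setP => i; rewrite !finset.inE.
by have := pos i; rewrite inE; case: (c i) => -[].
Qed.

Lemma discrete_law_layers u a : (0 < a <= N)%N -> discrete_law u a =
  \sum_(1 <= r < a.+1)
    \sum_(I : {ffun 'I_r.+1 -> {set 'I_N}} | layered (N - a)%N [set: 'I_N]%SET I)
      layer_product u a (fun j => #|I j|) I.
Proof.
case/andP=> a0 aN; rewrite discrete_lawE big_ltn //.
rewrite [X in X + _]big_pred0 ?add0r => [|c]; last first.
  (* With no sweep at all the cascade has size 0. *)
  by rewrite /stops; case: (a) a0.
by apply: eq_big_nat => r /andP[r0 _]; exact: sum_stops_layers.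
Qed.

End discrete_law.

(** * Hitting codes and the avalanche *)

Local Open Scope classical_set_scope.
Local Open Scope ring_scope.

Section hitting.
Set Implicit Arguments.
Unset Strict Implicit.

(** The first hitting time of [U], capped at N + 1. *)
Definition hit_code (T : Type) N (S : T -> T) (U : set T) (x : T) : 'I_N.+2 :=
  inord (find (fun l => iter l S x \in U) (iota 0 N.+1)).

Lemma hit_codeE (T : Type) N (S : T -> T) (U : set T) x :
  hit_code N S U x = find (fun l => iter l S x \in U) (iota 0 N.+1) :> nat.
Proof. by rewrite inordK // ltnS -[leqRHS](size_iota 0 N.+1) find_size. Qed.

Lemma hit_code_le (T : Type) N (S : T -> T) (U : set T) x b : (b <= N)%N ->
  (hit_code N S U x <= b)%N = [exists l : 'I_b.+1, iter l S x \in U].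
Proof.
move=> bN; rewrite hit_codeE; set p := fun l => _.
apply/idP/existsP => [le|[l pl]].
  exists (Ordinal (le : (_ < b.+1)%N)) => /=.
  have lt : (find p (iota 0 N.+1) < N.+1)%N by exact: leq_ltn_trans le _.
  have := @nth_find _ 0%N p (iota 0 N.+1).
  by rewrite has_find size_iota nth_iota // add0n; apply.
have lN : (l < N.+1)%N by exact: leq_trans (ltn_ord l) _.
rewrite leqNgt; apply/negP => lt.
have := before_find 0%N (leq_ltn_trans (ltn_ord l : (l <= b)%N) lt).
by rewrite nth_iota // add0n /p pl.
Qed.

Lemma hit_codeP (T : Type) N (S : T -> T) (U : set T) x j : (j <= N)%N ->
  hit_code N S U x = j :> nat <->
  U (iter j S x) /\ forall l, (l < j)%N -> ~ U (iter l S x).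
Proof.
move=> jN; split=> [e|[Uj nU]].
  split=> [|l lj Ul].
    have /existsP[l] : [exists l : 'I_j.+1, iter l S x \in U].
      by rewrite -(hit_code_le S U x jN) e.
    rewrite inE; have [->//|lj] := eqVneq (l : nat) j.
    have l_lt_j : (l < j)%N by rewrite ltn_neqAle lj -ltnS ltn_ord.
    move=> Ul; have : (hit_code N S U x <= l)%N.
      rewrite hit_code_le; last by lia.
      by apply/existsP; exists ord_max; rewrite inE.
    by rewrite e leqNgt l_lt_j.
  have : (hit_code N S U x <= l)%N.
    rewrite hit_code_le; last by lia.
    by apply/existsP; exists ord_max; rewrite inE.
  by rewrite e leqNgt lj.
apply/eqP; rewrite eqn_leq; apply/andP; split.
  by rewrite hit_code_le //; apply/existsP; exists ord_max; rewrite inE.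
rewrite leqNgt; apply/negP => lt.
have : (hit_code N S U x <= hit_code N S U x)%N by [].
rewrite hit_code_le; last by lia.
case/existsP => l; rewrite inE; apply: nU.
exact: leq_ltn_trans (ltn_ord l : (l <= hit_code N S U x)%N) lt.
Qed.

Section avalanche_code.
Variables (N : nat) (X : 'I_N -> Type).
Variables (S : forall i, X i -> X i) (U : forall i, set (X i)) (x : forall i, X i).
Arguments S : clear implicits.
Arguments U : clear implicits.
Let c i : nat := hit_code N (S i) (U i) (x i).

Lemma avalanche_step_activated b : (b <= N)%N ->
  avalanche_step S U x b = activated c b.
Proof.
by move=> bN; apply: eq_card => i; rewrite finset.inE hit_code_le.
Qed.

Lemma avalanche_seq_sweep k : avalanche_seq S U x k.+1 = sweep c k.+1.
Proof.
elim: k => [|k IH].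
  apply: eq_card => i; rewrite finset.inE [in RHS]hit_code_le // inE.
  apply/idP/existsP => [Ui|[l]]; first by exists ord0.
  by rewrite (ord1 l).
rewrite /avalanche_seq /= -/(avalanche_seq S U x k.+1) IH avalanche_step_activated //.
by rewrite /sweep iterS -[leqRHS]card_ord max_card.
Qed.

(** Starting from #{i : x_i in U_i} amounts to starting one step earlier from 0,
    and after reaching a fixed point the iteration no longer moves. *)
Lemma avalanche_sizeP a :
  avalanche_size S U x = a <-> exists2 r, (r <= a)%N & stops c r a.
Proof.
rewrite /avalanche_size; case: ex_minnP => -[//|k] /andP[_].
rewrite !avalanche_seq_sweep => /eqP fixed _.
have {}fixed : activated c (sweep c k.+1) = sweep c k.+1 by exact: fixed.
split=> [e|[r _ /and3P[/eqP ra /eqP aa _]]].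
  by apply: (stops_exists e); rewrite -e.
have := leq_maxl k.+1 r; have := leq_maxr k.+1 r.
move=> /(sweep_stable ra aa) <- /(sweep_stable erefl fixed) <- //.
Qed.

Lemma avalanche_size_stops a :
  (avalanche_size S U x = a) = [exists r : 'I_a.+1, stops c r a] :> Prop.
Proof.
apply/propext; rewrite avalanche_sizeP; split=> [[r ra sr]|/existsP[r sr]].
  by apply/existsP; exists (Ordinal (ra : (r < a.+1)%N)).
by exists r => //; rewrite -ltnS.
Qed.
End avalanche_code.

Lemma measure_finType_preimage d (T : measurableType d) (R : realType)
    (mu : {measure set T -> \bar R}) (I : finType) (f : T -> I) (P : pred I) :
  (forall i, measurable [set x | f x = i]) ->
  mu [set x | P (f x)] = (\sum_(i | P i) mu [set x | f x = i])%E.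
Proof.
move=> mf.
have -> : [set x | P (f x)] = \bigcup_(i in [set` P]) [set x | f x = i].
  apply/seteqP; split=> [x Px|x [i Pi e]]; last by rewrite /= e.
  by exists (f x).
rewrite measure_fin_bigcup //.
- apply: esym; apply: bigfs; first exact: index_enum_uniq.
  by move=> i _; rewrite mem_index_enum.
- by move=> i j _ _ [x [/= <- <-]].
Qed.

End hitting.

(** * The law of the hitting time of the top of a tower *)

Section hitting_law.
Set Implicit Arguments.
Unset Strict Implicit.
Context (R : realType) (X : pmetricType R) (S : X -> X) (U : set X).
Context (mu : probability (borel X) R) (n : nat) (B : set X).
Hypotheses (contS : continuous S) (openU : open U) (towerS : is_tower S n B U).
Hypothesis invS : invariant_measure (S : borel X -> borel X) mu.
Hypothesis leakS : mu.-negligible (tower_leak S n B U).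

Lemma open_measurable_borel (E : set X) : open E -> measurable (E : set (borel X)).
Proof. exact: sub_sigma_algebra. Qed.

Lemma open_preimage_iter (E : set X) j : open E -> open (iter j S @^-1` E).
Proof.
by elim: j E => // j IH E oE; apply: (IH (S @^-1` E)); move/continuousP: contS; apply.
Qed.

Lemma measure_preimage_iter (E : set X) j : open E -> mu (iter j S @^-1` E) = mu E.
Proof.
move=> oE; elim: j => // j IH.
have -> : iter j.+1 S @^-1` E = S @^-1` (iter j S @^-1` E).
  by apply/funext => x; rewrite /preimage /mkset iterSr.
rewrite invS //; apply: open_measurable_borel; exact: open_preimage_iter.
Qed.

(** By invariance the set of early returns has the measure of its preimage under
    n - d steps. The preimage lies in the leak: a point of it in the base would
    reach a point common to levels n - d and n of the tower. *)
Lemma early_return_null d : (0 < d <= n)%N -> mu (U `&` iter d S @^-1` U) = 0%E.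
Proof.
move=> /andP[d0 dn]; have oUd : open (U `&` iter d S @^-1` U).
  by apply: openI => //; exact: open_preimage_iter.
rewrite -(measure_preimage_iter (n - d) oUd); apply: measure_negligible.
  by apply: open_measurable_borel; exact: open_preimage_iter.
apply: negligibleS leakS => x [Ux]; rewrite /preimage /= -iterD subnKC // => Unx.
split=> // Bx; have [disj top] := towerS.
move: Ux; rewrite -[X in X _]top => -[y By yx].
have := disj (n - d)%N n; rewrite /= !ltnS leq_subr leqnn => /(_ isT isT).
have -> : ((n - d)%N = n) = False by apply/propext; split=> //; lia.
apply; exists (iter (n - d) S x); split; first by exists x.
by exists y.
Qed.

Lemma overlap_null l j : (l < j <= n)%N ->
  mu (iter l S @^-1` U `&` iter j S @^-1` U) = 0%E.
Proof.
move=> /andP[lj jn].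
have -> : iter l S @^-1` U `&` iter j S @^-1` U =
    iter l S @^-1` (U `&` iter (j - l) S @^-1` U).
  by apply/seteqP; split=> x; rewrite /preimage /= -iterD subnK // ltnW.
rewrite measure_preimage_iter; last by apply: openI => //; exact: open_preimage_iter.
by apply: early_return_null; lia.
Qed.

Variable N : nat.

Lemma hit_code_preimage (j : 'I_N.+2) : (j <= N)%N ->
  [set x | hit_code N S U x = j] =
  iter j S @^-1` U `\` \bigcup_(l in [set l | (l < j)%N]) iter l S @^-1` U.
Proof.
move=> jN; apply/seteqP; split=> x /=.
  move=> e; have [Uj nU] := (hit_codeP S U x jN).1 (congr1 _ e).
  by split=> // -[l /= lj Ul]; exact: nU lj Ul.
move=> [Uj nU]; apply/val_inj/(hit_codeP S U x jN); split=> // l lj Ul.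
by apply: nU; exists l.
Qed.

Lemma open_earlier (j : nat) :
  open (\bigcup_(l in [set l | (l < j)%N]) iter l S @^-1` U).
Proof. by apply: bigcup_open => l _; exact: open_preimage_iter. Qed.

Lemma measurable_hit_code (j : 'I_N.+2) :
  measurable ([set x | hit_code N S U x = j] : set (borel X)).
Proof.
have small (i : 'I_N.+2) : (i <= N)%N ->
    measurable ([set x | hit_code N S U x = i] : set (borel X)).
  move=> iN; rewrite hit_code_preimage //; apply: measurableD.
    by apply: open_measurable_borel; exact: open_preimage_iter.
  by apply: open_measurable_borel; exact: open_earlier.
have [/small//|jN] := leqP j N.
have -> : [set x | hit_code N S U x = j] =
    ~` \bigcup_(l in [set l | (l < N.+1)%N]) iter l S @^-1` U.
  apply/seteqP; split=> x /=.
    move=> e [l /= lN Ul]; move: jN; rewrite -e ltnNge => /negP; apply.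
    by rewrite hit_code_le //; apply/existsP; exists (Ordinal lN); rewrite inE.
  move=> nU; apply/val_inj => /=; apply/eqP; rewrite eqn_leq.
  have := ltn_ord j; have := ltn_ord (hit_code N S U x).
  have : ~~ (hit_code N S U x <= N)%N; last by lia.
  rewrite hit_code_le //; apply/negP => /existsP[l]; rewrite inE => Ul.
  by apply: nU; exists (nat_of_ord l) => //; exact: ltn_ord.
by apply: measurableC; apply: open_measurable_borel; exact: open_earlier.
Qed.

Hypothesis Nn : (N <= n)%N.

(** Hitting [U] at time [j] for the first time differs from hitting it at time [j]
    by a null set, since two hits within [n] steps have measure zero. *)
Lemma measure_hit_code_le (j : 'I_N.+2) : (j <= N)%N ->
  mu [set x | hit_code N S U x = j] = mu U.
Proof.
move=> jN; rewrite hit_code_preimage //.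
have mV i : measurable (iter i S @^-1` U : set (borel X)).
  by apply: open_measurable_borel; exact: open_preimage_iter.
have mW := open_measurable_borel (open_earlier j).
rewrite measureD //; last by apply: le_lt_trans (probability_le1 _ _) _; rewrite ?ltry.
rewrite -[RHS](measure_preimage_iter j openU) -[RHS]sube0; congr (_ - _)%E.
apply: measure_negligible; first exact: measurableI.
pose F l : set (borel X) :=
  if (l < j)%N then iter l S @^-1` U `&` iter j S @^-1` U else set0.
apply: (@negligibleS _ _ _ _ (\bigcup_l F l)).
  by move=> x [Uj [l /= lj Ul]]; exists l => //; rewrite /F lj.
apply: negligible_bigcup => l; rewrite /F; case: ifP => lj; last exact: negligible_set0.
exists (iter l S @^-1` U `&` iter j S @^-1` U); split=> //; first exact: measurableI.
by apply: overlap_null; rewrite lj (leq_trans jN).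
Qed.

(** The value N + 1 carries the mass left over by the values 0, ..., N. *)
Lemma measure_hit_code (j : 'I_N.+2) :
  mu [set x | hit_code N S U x = j] =
  (if (j <= N)%N then fine (mu U) else 1 - N.+1%:R * fine (mu U))%:E.
Proof.
have muU : mu U = (fine (mu U))%:E.
  by rewrite fineK // fin_num_measure //; exact: open_measurable_borel.
case: ifP => [jN|/negbT jN]; first by rewrite measure_hit_code_le // -muU.
have -> : j = ord_max by apply/val_inj => /=; have := ltn_ord j; lia.
have : (\sum_j mu [set x | hit_code N S U x = j] = 1)%E.
  rewrite -[RHS](probability_setT mu).
  transitivity (mu [set x | predT (hit_code N S U x)]).
    by apply: esym; exact: (measure_finType_preimage mu predT measurable_hit_code).
  by congr (mu _); apply/seteqP; split.
rewrite big_ord_recr /= (eq_bigr (fun=> (fine (mu U))%:E)); last first.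
  by move=> i _; rewrite -muU measure_hit_code_le //; have := ltn_ord i; rewrite ltnS.
rewrite sumEFin sumr_const card_ord.
have := fin_num_measure mu _ (measurable_hit_code ord_max).
move=> /fineK <-; rewrite -EFinD => -[e]; congr EFin.
by rewrite -[X in _ = X - _]e mulr_natl addrAC subrr add0r.
Qed.

End hitting_law.

(** * The law of the avalanche size *)

Section product_law.
Set Implicit Arguments.
Unset Strict Implicit.
Context (R : realType) (N : nat) (X : 'I_N -> pmetricType R).
Context (S : forall i, X i -> X i) (U : forall i, set (X i)).
Context (m : probability (product_space X) R).
Arguments S : clear implicits.
Arguments U : clear implicits.

Definition hit_codes (x : product_space X) : {ffun 'I_N -> 'I_N.+2} :=
  [ffun i : 'I_N => hit_code N (S i) (U i) (x i)].

Lemma hit_codes_box c : [set x | hit_codes x = c] =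
  [set x | forall i, [set y | hit_code N (S i) (U i) y = c i] (x i)].
Proof.
apply/seteqP; split=> x /= e; first by move=> i; rewrite -e ffunE.
by apply/ffunP => i; rewrite ffunE.
Qed.

Lemma measurable_box (E : forall i, set (borel (X i))) :
  (forall i, measurable (E i)) ->
  measurable ([set x | forall i, E i (x i)] : set (product_space X)).
Proof.
move=> mE.
have -> : [set x : product_space X | forall i, E i (x i)] =
    \bigcap_(i in [set: 'I_N]) ((fun x : product_space X => x i) @^-1` E i).
  by apply/seteqP; split=> x /= H i => [_|]; exact: H.
apply: fin_bigcap_measurable => // i _.
by apply: sub_sigma_algebra; exists i; exists (E i).
Qed.

Lemma avalanche_size_hit_codes a :
  [set x | avalanche_size S U x = a] =
  [set x | [exists r : 'I_a.+1, stops (fun i => hit_codes x i) r a]].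
Proof.
apply/funext => x /=; rewrite avalanche_size_stops.
suff -> : (fun i => hit_code N (S i) (U i) (x i) : nat) =
  (fun i => hit_codes x i : nat) by [].
by apply/funext => i; rewrite ffunE.
Qed.

Lemma avalanche_discrete_law (mi : forall i, probability (borel (X i)) R)
    (u : 'I_N -> R) a :
  is_product_measure mi m ->
  (forall i (j : 'I_N.+2),
     measurable ([set y | hit_code N (S i) (U i) y = j] : set (borel (X i)))) ->
  (forall i (j : 'I_N.+2),
     mi i [set y | hit_code N (S i) (U i) y = j] = (hit_weight u i j)%:E) ->
  m [set x | avalanche_size S U x = a] = (discrete_law u a)%:E.
Proof.
move=> hm mcode lcode; rewrite avalanche_size_hit_codes.
rewrite (measure_finType_preimage m (fun c : {ffun 'I_N -> 'I_N.+2} =>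
  [exists r : 'I_a.+1, stops (fun i => c i) r a])) => [|c]; last first.
  by rewrite hit_codes_box; exact: (measurable_box (fun i => mcode i (c i))).
rewrite -sumEFin; apply: eq_bigr => c _.
rewrite -prodEFin hit_codes_box; apply: etrans (hm _ (fun i => mcode i (c i))) _.
by apply: eq_bigr => i _; exact: lcode.
Qed.
End product_law.

Theorem theorem3p7 (R : realType) (N : nat) (hN : (1 <= N)%N)
  (X : 'I_N -> pmetricType R)
  (S : forall i, X i -> X i)
  (hS : forall i, continuous (S i))
  (U : forall i, set (X i))
  (hU : forall i, open (U i))
  (n : 'I_N -> nat)
  (hn : forall i, (N < n i + 1)%N)
  (B : forall i, set (X i))
  (hB : forall i, is_tower (S i) (n i) (B i) (U i))
  (mi : forall i, probability (borel (X i)) R)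
  (hinv : forall i, invariant_measure (S i : borel (X i) -> borel (X i)) (mi i))
  (herg : forall i, ergodic (S i : borel (X i) -> borel (X i)) (mi i))
  (hleak : forall i,
     (mi i).-negligible (tower_leak (S i) (n i) (B i) (U i)))
  (m : probability (product_space X) R)
  (hm : is_product_measure mi m) :
  let A := avalanche_size S U in
  let u i : R := fine (mi i (U i)) in
  [/\ forall a : nat, (1 <= a <= N)%N ->
        m [set x | A x = a] =
        (\sum_(1 <= r < a.+1)
           \sum_(k : {ffun 'I_r.+1 -> 'I_N.+1} | in_K a k)
             \sum_(I : {ffun 'I_r.+1 -> {set 'I_N}} | ordered_partition k I)
               ((\prod_(i in I ord0) u i)
                * (\prod_(1 <= l < r) \prod_(i in I (inord l))
                     ((k (inord l.-1))%:R * u i))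
                * \prod_(i in I ord_max) (1 - a.+1%:R * u i)))%:E,
      m [set x | A x = 0%N] = (\prod_(i < N) (1 - u i))%:E &
      forall p : R, (forall i, mi i (U i) = p%:E) ->
        forall a : nat, (a <= N)%N ->
        m [set x | A x = a] =
        (a.+1%:R ^ (a%:Z - 1) * 'C(N, a)%:R * p ^+ a
         * (1 - a.+1%:R * p) ^+ (N - a))%:E].
Proof.
move=> A u.
have Nn i : (N <= n i)%N by rewrite -ltnS -[(n i).+1]addn1.
have law a : m [set x | A x = a] = (discrete_law u a)%:E.
  apply: avalanche_discrete_law hm _ _ => i j.
    exact: (measurable_hit_code (hS i) (hU i)).
  exact: (measure_hit_code (hS i) (hU i) (hB i) (hinv i) (hleak i) (Nn i)).
split.
- move=> a aN; rewrite law discrete_law_layers //; congr EFin; apply: eq_bigr => r _.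
  by rewrite -sum_ordered_partition //; case/andP: aN.
- by rewrite law discrete_law0.
move=> p up a aN; rewrite law; congr EFin.
have -> : u = fun=> p by apply/funext => i; rewrite /u up.
(* For a = 0 the exponent a - 1 is -1, taken of the base 1. *)
case: a aN => [|a] aN.
  rewrite discrete_law0 prodr_const card_ord bin0 expr0 subn0 !mulr1.
  by rewrite (_ : 0%:Z - 1 = -1) // exprN1 invr1 !mul1r.
rewrite discrete_law_layers // sum_layer_product_const //.
rewrite (_ : a.+1%:Z - 1 = a%:Z); last by lia.
by rewrite -exprnP natrM natrX !mulrA.
Qed.
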